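(* Let $1\le r\le n$. The first order $D_n^r(h^1)$ of $D_n^r$ (the coefficient of $h$ in its $h$-expansion) is $$\binom{n-1}{r-1}L_1+\frac{\beta r}{2}\binom{n}{r}(n-1),\qquad L_1=\sum_{i=1}^n x_i\partial_i.$$
   Context: Macdonald operators: for $1\le r\le n$, $$D_n^r=t^{r(r-1)/2}\sum_{I\subset\{1,\dots,n\},\,|I|=r}\ \prod_{i\in I,\,j\notin I}\frac{t x_i-x_j}{x_i-x_j}\ \prod_{i\in I}T_{q,x_i},\qquad T_{q,x_i}f(x_1,\dots,x_i,\dots,x_n)=f(x_1,\dots,qx_i,\dots,x_n),$$ acting on symmetric functions (polynomials) in $x_1,\dots,x_n$. Put $q=\exp(h)$, $t=\exp(\beta h)$ with $\beta$ a parameter, so $T_{q,x_i}=\exp(h\,x_i\partial_i)$, $\partial_i=\partial/\partial x_i$, and expand around $h=0$: $D_n^r=\sum_{k\ge0}D_n^r(h^k)\,h^k$. The operator $D_n^r(h^k)$ is called the $k$-th order of $D_n^r$. *)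

(* Defs.v *)
From HB Require Import structures.
From mathcomp Require Import all_boot all_order all_algebra.
From mathcomp Require Import boolp.
From mathcomp Require Export mpoly.

Set Implicit Arguments.
Unset Strict Implicit.
Unset Printing Implicit Defensive.

Import GRing.Theory.
Local Open Scope ring_scope.

(* [fps R] is the ring R[[h]] of formal power series in one variable h; a     *)
(* series is the sequence of its coefficients, and [s`[k]] is the coefficient *)
(* of h^k in s.                                                               *)
Record fps (R : Type) := Fps { fps_coef : nat -> R }.

Notation "s `[ k ]" := (fps_coef s k)
  (at level 3, k at level 99, left associativity, format "s `[ k ]").

HB.instance Definition _ (R : Type) := gen_eqMixin (fps R).
HB.instance Definition _ (R : Type) := gen_choiceMixin (fps R).

Lemma fps_eqP (R : Type) (s u : fps R) : (forall k, s`[k] = u`[k]) -> s = u.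
Proof. by case: s u => [s] [u] /= e; congr Fps; apply/funext. Qed.

Section FpsRing.
Context {R : comNzRingType}.
Implicit Types (s u v : fps R).

Definition fpsC (c : R) : fps R := Fps (fun k => if k is 0 then c else 0).
Definition fps_opp s : fps R := Fps (fun k => - s`[k]).
Definition fps_add s u : fps R := Fps (fun k => s`[k] + u`[k]).
Definition fps_mul s u : fps R :=
  Fps (fun k => \sum_(i < k.+1) s`[i] * u`[k - i]).

Fact fps_addA : associative fps_add.
Proof. by move=> s u v; apply/fps_eqP => k /=; rewrite addrA. Qed.
Fact fps_addC : commutative fps_add.
Proof. by move=> s u; apply/fps_eqP => k /=; rewrite addrC. Qed.
Fact fps_add0 : left_id (fpsC 0) fps_add.
Proof. by move=> s; apply/fps_eqP => -[|k] /=; rewrite add0r. Qed.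
Fact fps_addN : left_inverse (fpsC 0) fps_opp fps_add.
Proof. by move=> s; apply/fps_eqP => -[|k] /=; rewrite addNr. Qed.

HB.instance Definition _ :=
  GRing.isZmodule.Build (fps R) fps_addA fps_addC fps_add0 fps_addN.

Let trunc (m : nat) s : {poly R} := \poly_(i < m) s`[i].

Let coef_mul s u (m k : nat) :
  (k < m)%N -> (fps_mul s u)`[k] = (trunc m s * trunc m u)`_k.
Proof.
move=> km; rewrite coefM; apply: eq_bigr => i _.
rewrite !coef_poly (leq_ltn_trans (leq_subr _ _) km).
by rewrite (leq_ltn_trans _ km) // -ltnS.
Qed.

Fact fps_mulC : commutative fps_mul.
Proof. by move=> s u; apply/fps_eqP => k; rewrite !(coef_mul _ _ (ltnSn k)) mulrC. Qed.

Fact fps_mulA : associative fps_mul.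
Proof.
move=> s u v; apply/fps_eqP => k.
have E w : w`[k] = (trunc k.+1 w)`_k by rewrite coef_poly ltnSn.
transitivity ((trunc k.+1 s * (trunc k.+1 u * trunc k.+1 v))`_k).
  rewrite (coef_mul _ _ (ltnSn k)) 2!coefM; apply: eq_bigr => i _.
  have ik : (k - i < k.+1)%N by rewrite ltnS leq_subr.
  by rewrite (coef_poly _ _ (k - i)) ik (coef_mul _ _ ik).
rewrite mulrA (coef_mul _ _ (ltnSn k)) 2!coefM; apply: eq_bigr => i _.
by rewrite [in RHS](coef_poly _ _ i) ltn_ord (coef_mul _ _ (ltn_ord i)).
Qed.

Fact fps_mul1 : left_id (fpsC 1) fps_mul.
Proof.
move=> s; apply/fps_eqP => k /=.
by rewrite big_ord_recl /= mul1r subn0 big1 ?addr0 // => i _; rewrite mul0r.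
Qed.

Fact fps_mulDl : left_distributive fps_mul fps_add.
Proof.
move=> s u v; apply/fps_eqP => k /=.
by rewrite -big_split /=; apply: eq_bigr => i _; rewrite mulrDl.
Qed.

Fact fps_1_neq0 : fpsC 1 != 0.
Proof. by apply/eqP => /(congr1 (fun s => s`[0])) /= /eqP; rewrite oner_eq0. Qed.

HB.instance Definition _ := GRing.Zmodule_isComNzRing.Build (fps R)
  fps_mulA fps_mulC fps_mul1 fps_mulDl fps_1_neq0.

Definition fps_unit : pred (fps R) := fun s => `[< exists u, u * s = 1 >].
Definition fps_inv s : fps R :=
  if pselect (exists u, u * s = 1) is left e then projT1 (cid e) else s.

Fact fps_mulVs : {in fps_unit, left_inverse 1 fps_inv *%R}.
Proof.
move=> s /asboolP su; rewrite /fps_inv.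
by case: pselect => // e; case: (cid e).
Qed.
Fact fps_unitP s u : u * s = 1 -> fps_unit s.
Proof. by move=> e; apply/asboolP; exists u. Qed.
Fact fps_inv_out : {in [predC fps_unit], fps_inv =1 id}.
Proof.
move=> s /asboolP su; rewrite /fps_inv.
by case: pselect.
Qed.

HB.instance Definition _ := GRing.ComNzRing_hasMulInverse.Build (fps R)
  fps_mulVs fps_unitP fps_inv_out.

End FpsRing.

(* exp(c h) *)
Definition fps_exp (F : fieldType) (c : F) : fps F :=
  Fps (fun k => c ^+ k / (k`!)%:R).

(* T_{q,x_i} and D_n^r on functions of n variables with values in S.          *)
Definition qshift (S : comUnitRingType) (n : nat) (q : S) (i : 'I_n)
    (f : ('I_n -> S) -> S) : ('I_n -> S) -> S :=
  fun x => f (fun j => if j == i then q * x j else x j).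

Definition macdonald (S : comUnitRingType) (n r : nat) (q t : S)
    (f : ('I_n -> S) -> S) : ('I_n -> S) -> S :=
  fun x =>
    t ^+ ((r * r.-1) %/ 2) *
    \sum_(I : {set 'I_n} | #|I| == r)
      (\prod_(i in I) \prod_(j in ~: I) ((t * x i - x j) / (x i - x j))) *
      (\big[(fun A B => A \o B)/id]_(i in I) qshift q i) f x.

Section HExpansion.
Context {K : fieldType} {n : nat}.

Definition mfrac : {mpoly K[n]} -> {fraction {mpoly K[n]}} := @tofrac _.

(* f in K[x_1, ..., x_n] as a function on K(x_1, ..., x_n)[[h]]^n *)
Definition mpoly_fun (f : {mpoly K[n]})
    (x : 'I_n -> fps {fraction {mpoly K[n]}}) : fps {fraction {mpoly K[n]}} :=
  mmap (fun c => fpsC (mfrac c%:MP)) x f.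

(* D_n^r(h^k) f: the coefficient of h^k in D_n^r f for q = exp(h) and         *)
(* t = exp(beta h), D_n^r f being computed in K(x_1, ..., x_n)[[h]] by        *)
(* evaluation at the generic point (x_1, ..., x_n).                           *)
Definition macdonald_order (r : nat) (beta : K) (k : nat) (f : {mpoly K[n]}) :
    {fraction {mpoly K[n]}} :=
  (macdonald r (fps_exp 1) (fps_exp (mfrac beta%:MP)) (mpoly_fun f)
     (fun i => fpsC (mfrac 'X_i)))`[k].

Definition euler_op (f : {mpoly K[n]}) : {mpoly K[n]} :=
  \sum_(i < n) 'X_i * f^`M(i).

End HExpansion.

(* Main.v *)
(* Everything is computed modulo h^2. For a series s with s`[1] = l * s`[0],  *)
(* l plays the role of the logarithmic derivative of s at h = 0, and it is    *)
(* additive under products. The I-th summand of D_n^r f thus contributes      *)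
(*   (beta r(r-1)/2 + beta sum_(i in I, j notin I) x_i/(x_i - x_j)) f         *)
(*     + sum_(i in I) x_i d_i f.                                              *)
(* Summing over I, the last term gives C(n-1, r-1) L_1 f. The number of I     *)
(* with i in I and j notin I is symmetric in i and j, and                     *)
(* x_i/(x_i - x_j) + x_j/(x_j - x_i) = 1, so twice the middle sum counts the  *)
(* triples (I, i, j), of which there are C(n, r) r (n - r).                   *)
From HB Require Import structures.
Require Import Defs.
From mathcomp Require Import all_boot all_order all_algebra.
From mathcomp Require Import boolp.
From mathcomp Require Import mpoly ring.

Set Implicit Arguments.
Unset Strict Implicit.
Unset Printing Implicit Defensive.

Import GRing.Theory.
Local Open Scope ring_scope.

(** At h = 0 one has q = t = 1, so every shift is the identity and every rational weight is 1. The
    coefficient of h is therefore a sum of logarithmic derivatives of the scalar factors, times f,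
    plus the first-order variation of f at the shifted point ([macdonald_order1E]). [sum_draws_mem]
    sums that variation over all subsets. The weights x_i/(x_i - x_j) need not have a constant sum
    over one subset; they do over all subsets, by the pairing in [sum_draws_split]. The scalar is
    then beta C(n,r) (r(r-1) + r(n-r))/2 = beta C(n,r) r(n-1)/2. *)

(** * Power series to first order *)

Section FpsCoef.
Context {R : comNzRingType}.
Implicit Types (s u : fps R) (k l : R).

Lemma fps_coef_sum (I : Type) (r : seq I) (P : pred I) (F : I -> fps R) m :
  (\sum_(i <- r | P i) F i)`[m] = \sum_(i <- r | P i) (F i)`[m].
Proof. by apply: (big_morph (fun s => s`[m])) => //; case: m. Qed.

Lemma fps_coef0M s u : (s * u)`[0] = s`[0] * u`[0].
Proof. by rewrite [LHS]big_ord_recl big_ord0 addr0. Qed.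

Lemma fps_coef1M s u : (s * u)`[1] = s`[0] * u`[1] + s`[1] * u`[0].
Proof. by rewrite [LHS]big_ord_recl big_ord1. Qed.

Lemma fps_coef0_prod (I : Type) (r : seq I) (P : pred I) (F : I -> fps R) :
  (\prod_(i <- r | P i) F i)`[0] = \prod_(i <- r | P i) (F i)`[0].
Proof. by apply: (big_morph (fun s => s`[0])) => //; apply: fps_coef0M. Qed.

Lemma fps_coef0X s m : (s ^+ m)`[0] = s`[0] ^+ m.
Proof. by elim: m => // m IH; rewrite !exprS fps_coef0M IH. Qed.

(** A division-free relation, meaningful even when the constant term is not invertible; [l] need not
    be unique. *)
Definition fps_logder s l := s`[1] = l * s`[0].

Lemma fps_logderC c : fps_logder (fpsC c) 0.
Proof. by rewrite /fps_logder mul0r. Qed.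

Lemma fps_logderM s u k l :
  fps_logder s k -> fps_logder u l -> fps_logder (s * u) (k + l).
Proof.
rewrite /fps_logder fps_coef0M fps_coef1M => -> ->; ring.
Qed.

Lemma fps_logderX s l m : fps_logder s l -> fps_logder (s ^+ m) (l *+ m).
Proof.
move=> sl; elim: m => [|m IH]; first exact: (fps_logderC 1).
by rewrite exprS mulrS; apply: fps_logderM.
Qed.

Lemma fps_logder_prod (I : Type) (r : seq I) (P : pred I) (F : I -> fps R)
    (l : I -> R) :
  (forall i, P i -> fps_logder (F i) (l i)) ->
  fps_logder (\prod_(i <- r | P i) F i) (\sum_(i <- r | P i) l i).
Proof.
move=> Fl; elim/big_rec2: _ => [|i x y Pi]; first exact: (fps_logderC 1).
exact/fps_logderM/Fl.
Qed.

Lemma fps_coefMC s c m : (s * fpsC c)`[m] = s`[m] * c.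
Proof.
rewrite [LHS]big_ord_recr /= subnn big1 ?add0r // => i _.
by rewrite -[(m - i)%N]prednK ?subn_gt0 // mulr0.
Qed.

Lemma fps_coefB s u m : (s - u)`[m] = s`[m] - u`[m].
Proof. by []. Qed.

Lemma fpsCM : {morph @fpsC R : c d / c * d}.
Proof.
move=> c d; apply/fps_eqP => m; rewrite fps_coefMC.
by case: m => //= m; rewrite mul0r.
Qed.

Lemma fpsCB : {morph @fpsC R : c d / c - d}.
Proof. by move=> c d; apply/fps_eqP => -[|m] //=; rewrite subr0. Qed.

End FpsCoef.

Lemma fpsCV (F : fieldType) (c : F) : c != 0 -> (fpsC c)^-1 = fpsC c^-1.
Proof.
move=> c0; have cV : fpsC c^-1 * fpsC c = 1 by rewrite -fpsCM mulVf.
have cU : fpsC c \is a GRing.unit.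
  by apply/unitrP; exists (fpsC c^-1); split; rewrite // mulrC.
by apply: (mulIr cU); rewrite mulVr.
Qed.

Lemma fps_exp_logder (F : fieldType) (c : F) : fps_logder (fps_exp c) c.
Proof. by rewrite /fps_logder /= !divr1 mulr1. Qed.

Lemma fps_exp0 (F : fieldType) (c : F) : (fps_exp c)`[0] = 1.
Proof. by rewrite /= divr1. Qed.

(** * First-order expansion of one rational weight *)

Section MacdonaldWeight.
Context {F : fieldType}.
Variables (b x y : F).
Hypothesis xy : x - y != 0.

Let w := (fps_exp b * fpsC x - fpsC y) / (fpsC x - fpsC y).

(** The denominator is constant in h, so the division acts coefficientwise. *)
Let coef_w m : w`[m] = ((fps_exp b)`[m] * x - (fpsC y)`[m]) / (x - y).
Proof. by rewrite /w -fpsCB fpsCV // fps_coefMC fps_coefB fps_coefMC. Qed.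

Lemma macdonald_weight0 : w`[0] = 1.
Proof. by rewrite coef_w fps_exp0 mul1r divff. Qed.

Lemma macdonald_weight_logder : fps_logder w (b * (x / (x - y))).
Proof.
rewrite /fps_logder macdonald_weight0 mulr1 coef_w fps_exp_logder fps_exp0.
by rewrite mulr1 subr0 mulrA.
Qed.

End MacdonaldWeight.

(** The indices of [I] are enumerated without repetition, so each coordinate is scaled at most
    once. *)
Lemma big_qshiftE (S : comUnitRingType) (n : nat) (q : S) (I : {set 'I_n})
    (f : ('I_n -> S) -> S) (x : 'I_n -> S) :
  (\big[(fun A B => A \o B)/id]_(i in I) qshift q i) f x =
  f (fun j => if j \in I then q * x j else x j).
Proof.
rewrite -big_filter.
have -> : f (fun j => if j \in I then q * x j else x j) =
          f (fun j => if j \in [seq i <- index_enum 'I_n | i \in I]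
                      then q * x j else x j).
  by congr f; apply/funext => j; rewrite mem_filter mem_index_enum andbT.
have: uniq [seq i <- index_enum 'I_n | i \in I].
  by rewrite filter_uniq ?index_enum_uniq.
(* The point [x] is generalised because the outermost shift changes the point at which the remaining
   ones are evaluated. *)
elim: (filter _ _) x => [|i s IH] x /=; first by rewrite big_nil.
case/andP=> si us; rewrite big_cons /= /qshift IH //.
congr f; apply/funext => j; rewrite inE.
by case: eqVneq => [->|//]; rewrite (negPf si).
Qed.

(** * Double counting over r-element subsets *)

Section SubsetCount.
Variables (T : finType) (r : nat).

(** Pascal's rule: the r-subsets avoiding [i] are the r-subsets of the complement of [i], and the
    remaining ones contain [i]. *)
Lemma card_draws_mem (i : T) :
  (0 < r)%N -> #|[set I : {set T} | #|I| == r & i \in I]| = 'C(#|T|.-1, r.-1).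
Proof.
move=> r0; have T0 : (0 < #|T|)%N by apply/card_gt0P; exists i.
have out : #|[set I : {set T} | #|I| == r & i \notin I]| = 'C(#|T|.-1, r).
  rewrite -[in RHS](cardsC1 i) -cards_draws; apply: eq_card => I.
  by rewrite !inE andbC subsetC sub1set inE.
have := card_draws T r; rewrite -(cardsID [set I : {set T} | i \in I]).
rewrite (_ : _ :&: _ = [set I : {set T} | #|I| == r & i \in I]); last first.
  by apply/setP => I; rewrite !inE.
rewrite (_ : _ :\: _ = [set I : {set T} | #|I| == r & i \notin I]); last first.
  by apply/setP => I; rewrite !inE andbC.
rewrite out -[in 'C(#|T|, r)](prednK T0) -[in 'C(_.+1, r)](prednK r0) binS.
by rewrite (prednK r0) addnC => /addnI.
Qed.

Definition card_split (i j : T) :=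
  #|[set I : {set T} | [&& #|I| == r, i \in I & j \notin I]]|.

(** Adding the subsets that contain both points to either side gives the number of r-subsets through
    one point, which does not depend on the point. *)
Lemma card_splitC (i j : T) : (0 < r)%N -> card_split i j = card_split j i.
Proof.
move=> r0; pose both := #|[set I : {set T} | [&& #|I| == r, i \in I & j \in I]]|.
have splitE k l : (both = #|[set I : {set T} | [&& #|I| == r, k \in I & l \in I]]|)
    -> (both + card_split k l = 'C(#|T|.-1, r.-1))%N.
  move=> ->; rewrite -(card_draws_mem k r0).
  rewrite -(cardsID [set I : {set T} | l \in I] [set I : {set T} | #|I| == r & k \in I]).
  by congr (_ + _)%N; apply: eq_card => I; rewrite !inE -?andbA // [RHS]andbC -andbA.
apply/(@addnI both); rewrite !splitE //.
by apply: eq_card => I; rewrite !inE [(j \in I) && _]andbC.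
Qed.

(** Exchanging the sums, each r-subset contributes one for every pair of an inside and an outside
    point. *)
Lemma sum_card_split :
  (\sum_i \sum_j card_split i j = 'C(#|T|, r) * (r * (#|T| - r)))%N.
Proof.
under eq_bigr => i _ do under eq_bigr => j _ do
  rewrite /card_split -sum1_card big_mkcond.
under eq_bigr => i _ do rewrite exchange_big.
rewrite exchange_big -card_draws -sum_nat_const big_mkcond /=.
rewrite [RHS]big_mkcond [LHS]big_mkcond /=.
apply: eq_bigr => I _; rewrite inE; case: eqP => [cI|/eqP/negPf cI]; last first.
  by rewrite big1 // => i _; rewrite big1 // => j _; rewrite inE cI.
have -> : (#|T| - r)%N = #|~: I| by rewrite [RHS]cardsCs setCK cI.
rewrite -cI -sum_nat_const [RHS]big_mkcond.
apply: eq_bigr => i _; case: ifP => iI; last first.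
  by rewrite big1 // => j _; rewrite inE iI !andbF.
rewrite -[#|~: I|]sum1_card [RHS]big_mkcond; apply: eq_bigr => j _.
by rewrite !inE cI eqxx iI.
Qed.

Variable V : comNzRingType.

Lemma sum_draws_mem (a : T -> V) :
  (0 < r)%N ->
  \sum_(I : {set T} | #|I| == r) \sum_(i in I) a i =
  'C(#|T|.-1, r.-1)%:R * \sum_i a i.
Proof.
move=> r0; rewrite (exchange_big_dep predT) //= mulr_sumr.
apply: eq_bigr => i _; rewrite sumr_const -(card_draws_mem i r0) mulr_natl.
by congr (_ *+ _); apply: eq_card => I; rewrite !inE.
Qed.

(** Since [card_split] is symmetric, the doubled sum pairs [w i j] with [w j i], and only the number
    of splittings remains. Stating it doubled avoids dividing by 2 in [V]. *)
Lemma sum_draws_split (w : T -> T -> V) :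
  (0 < r)%N -> (forall i j, i != j -> w i j + w j i = 1) ->
  (\sum_(I : {set T} | #|I| == r) \sum_(i in I) \sum_(j in ~: I) w i j) *+ 2 =
  ('C(#|T|, r) * (r * (#|T| - r)))%:R.
Proof.
move=> r0 w1.
have -> : \sum_(I : {set T} | #|I| == r) \sum_(i in I) \sum_(j in ~: I) w i j =
          \sum_i \sum_j w i j *+ card_split i j.
  rewrite (exchange_big_dep predT) //=; apply: eq_bigr => i _.
  rewrite (exchange_big_dep predT) //=; apply: eq_bigr => j _.
  rewrite sumr_const; congr (_ *+ _); apply: eq_card => I.
  by rewrite unfold_in !inE andbA.
rewrite -sum_card_split natr_sum mulr2n [X in X + _]exchange_big -big_split /=.
apply: eq_bigr => i _; rewrite natr_sum -big_split; apply: eq_bigr => j _ /=.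
rewrite (card_splitC j i r0) -mulrnDl; have [<-|ij] := eqVneq i j.
  (* Nothing is known about [w i i], but no subset both contains and avoids [i]. *)
  rewrite (_ : card_split i i = 0%N) // /card_split.
  by apply/eqP; rewrite cards_eq0; apply/eqP/setP => I; rewrite !inE andbN andbF.
by rewrite w1 // eq_sym.
Qed.

End SubsetCount.

(** * Expansion at the generic point *)

Section GenericPoint.
Context {K : fieldType} {n : nat}.
Implicit Types (f : {mpoly K[n]}) (I : {set 'I_n}).
Local Notation F := {fraction {mpoly K[n]}}.

HB.instance Definition _ :=
  GRing.RMorphism.copy (@mfrac K n) (@tofrac {mpoly K[n]}).

Lemma mfracX_sub_neq0 (i j : 'I_n) : i != j -> mfrac 'X_i - mfrac 'X_j != 0 :> F.
Proof.
move=> ij; rewrite -rmorphB tofrac_eq0 subr_eq0; apply: contra ij => /eqP e.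
have /eqP := congr1 (fun p : {mpoly K[n]} => p@_U_(i)) e.
by rewrite !mcoeffXU eqxx [j == i]eq_sym; case: (i == j); rewrite ?oner_eq0.
Qed.

Definition shifted_point I (j : 'I_n) : fps F :=
  if j \in I then fps_exp 1 * fpsC (mfrac 'X_j) else fpsC (mfrac 'X_j).

Lemma shifted_point0 I j : (shifted_point I j)`[0] = mfrac 'X_j.
Proof.
by rewrite /shifted_point; case: ifP => // _; rewrite fps_coef0M fps_exp0 mul1r.
Qed.

Lemma shifted_point_logder I j : fps_logder (shifted_point I j) (j \in I)%:R.
Proof.
rewrite /shifted_point; case: ifP => _; last exact: fps_logderC.
rewrite -[1%:R]addr0; apply: fps_logderM; [exact: fps_exp_logder | exact: fps_logderC].
Qed.

Lemma mmap1_shifted0 I (m : 'X_{1..n}) :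
  (mmap1 (shifted_point I) m)`[0] = mfrac 'X_[m].
Proof.
rewrite /mmap1 fps_coef0_prod (mpolyXE_id K m) rmorph_prod /=.
by apply: eq_bigr => i _; rewrite fps_coef0X shifted_point0 rmorphXn.
Qed.

(** Each variable in [I] carries a factor exp(h), so the logarithmic derivative is the degree in
    these variables. By [mpolyX_mul_mderiv] this is the eigenvalue on the monomial of the sum of x_i
    d_i over [I]. *)
Lemma mmap1_shifted_logder I (m : 'X_{1..n}) :
  fps_logder (mmap1 (shifted_point I) m) (\sum_(i in I) (m i)%:R).
Proof.
rewrite big_mkcond; apply: fps_logder_prod => i _.
have := fps_logderX (m i) (shifted_point_logder I i).
by case: ifP => // _; rewrite mul0rn.
Qed.

Lemma mpolyX_mul_mderiv (m : 'X_{1..n}) (i : 'I_n) :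
  'X_i * ('X_[m])^`M(i) = (m i)%:R *: 'X_[m] :> {mpoly K[n]}.
Proof.
(* Exponent 0 is separate: the truncated subtraction of monomials cannot be undone there, but the
   scalar vanishes. *)
rewrite mderivX -scalerAr; have [->|mi] := eqVneq (m i) 0%N; first by rewrite !scale0r.
rewrite -mpolyXD addmC submK //; apply/mnm_lepP => j; rewrite mnm1E.
by case: eqVneq => // <-; rewrite lt0n.
Qed.

Lemma mpoly_fun_shifted0 I f : (mpoly_fun f (shifted_point I))`[0] = mfrac f.
Proof.
rewrite /mpoly_fun /mmap fps_coef_sum [in RHS](mpolyE f) rmorph_sum.
apply: eq_bigr => m _.
by rewrite fps_coef0M mmap1_shifted0 /= -rmorphM mul_mpolyC.
Qed.

(** A general [f] has no single logarithmic derivative, so the eigenvalue identity is applied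
    monomial by monomial and summed linearly. *)
Lemma mpoly_fun_shifted1 I f :
  (mpoly_fun f (shifted_point I))`[1] =
  \sum_(i in I) mfrac ('X_i * f^`M(i)).
Proof.
rewrite /mpoly_fun /mmap fps_coef_sum [in RHS](mpolyE f).
under [RHS]eq_bigr => i _ do rewrite raddf_sum mulr_sumr rmorph_sum.
rewrite [RHS]exchange_big; apply: eq_bigr => m _.
rewrite fps_coef1M /= mul0r addr0 mmap1_shifted_logder mmap1_shifted0.
rewrite mulrCA -rmorphM mulr_suml mul_mpolyC; apply: eq_bigr => i _.
rewrite mderivZ -scalerAr mpolyX_mul_mderiv scalerA [f@_m * _]mulrC -scalerA.
by rewrite scaler_nat rmorphMn mulr_natl.
Qed.

Lemma macdonald_order1E (r : nat) (beta : K) f :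
  macdonald_order r beta 1 f =
  \sum_(I : {set 'I_n} | #|I| == r)
    ((mfrac beta%:MP *+ ((r * r.-1) %/ 2)
      + \sum_(i in I) \sum_(j in ~: I)
          mfrac beta%:MP * (mfrac 'X_i / (mfrac 'X_i - mfrac 'X_j))) * mfrac f
     + \sum_(i in I) mfrac ('X_i * f^`M(i))).
Proof.
rewrite /macdonald_order /macdonald mulr_sumr fps_coef_sum.
apply: eq_bigr => I _; rewrite big_qshiftE -/(shifted_point I) mulrA fps_coef1M.
have ij i j : i \in I -> j \in ~: I -> mfrac 'X_i - mfrac 'X_j != 0 :> F.
  rewrite inE => iI jI; apply: mfracX_sub_neq0.
  by apply: contraNneq jI => <-.
set P := \prod_(i in I) _; set E := fps_exp _.
have EP : fps_logder (E ^+ ((r * r.-1) %/ 2) * P)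
   (mfrac beta%:MP *+ ((r * r.-1) %/ 2) + \sum_(i in I) \sum_(j in ~: I)
      mfrac beta%:MP * (mfrac 'X_i / (mfrac 'X_i - mfrac 'X_j))).
  apply: fps_logderM; first exact/fps_logderX/fps_exp_logder.
  apply: fps_logder_prod => i iI; apply: fps_logder_prod => j jI.
  exact/macdonald_weight_logder/ij.
(* With constant term 1, the scalar factor has its logarithmic derivative as coefficient of h. *)
have EP0 : (E ^+ ((r * r.-1) %/ 2) * P)`[0] = 1.
  rewrite fps_coef0M fps_coef0X fps_exp0 expr1n mul1r fps_coef0_prod.
  rewrite big1 // => i iI; rewrite fps_coef0_prod big1 // => j jI.
  exact/macdonald_weight0/ij.
by rewrite EP EP0 mul1r mulr1 mpoly_fun_shifted0 mpoly_fun_shifted1 addrC.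
Qed.

End GenericPoint.

Theorem proposition4p3 (K : fieldType) (charK0 : [pchar K] =i pred0)
    (beta : K) (n r : nat) (r_ge1 : (1 <= r)%N) (r_le_n : (r <= n)%N)
    (f : {mpoly K[n]}) (f_sym : f \is symmetric) :
  macdonald_order r beta 1 f =
  mfrac ('C(n.-1, r.-1)%:R *: euler_op f
         + (beta * r%:R / 2%:R * 'C(n, r)%:R * (n%:R - 1)) *: f).
Proof.
rewrite macdonald_order1E big_split /= sum_draws_mem // card_ord.
rewrite -mulr_suml big_split /= sumr_const.
have -> : #|[pred I : {set 'I_n} | #|I| == r]| = 'C(n, r).
  by rewrite -[in RHS](card_ord n) -card_draws; apply: eq_card => I; rewrite !inE.
under eq_bigr => I _ do under eq_bigr => i _ do rewrite -mulr_sumr.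
under eq_bigr => I _ do rewrite -mulr_sumr.
rewrite -mulr_sumr; set W := \sum_(I | _) _.
have W2 : W *+ 2 = ('C(n, r) * (r * (n - r)))%:R.
  have := sum_draws_split (w := fun i j : 'I_n =>
    mfrac 'X_i / (mfrac 'X_i - mfrac 'X_j : {fraction {mpoly K[n]}})) r_ge1.
  rewrite card_ord; apply=> i j ij.
  have d := mfracX_sub_neq0 (K := K) ij.
  by rewrite -[X in _ + _ / X]opprB invrN mulrN -mulrBl divff.
have two : 2%:R != 0 :> K.
  by have := charK0 2%N; rewrite !inE /= => ->.
have twoF : 2%:R != 0 :> {fraction {mpoly K[n]}}.
  by rewrite -(rmorph_nat (@mfrac K n)) tofrac_eq0 -mpolyC_nat mpolyC_eq0.
rewrite rmorphD /= scaler_nat rmorphMn /= mulr_natl /euler_op rmorph_sum addrC.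
(* The Euler parts agree; the scalar parts are compared after doubling, since only [W *+ 2] is
   known. *)
congr (_ + _); apply: (mulfI twoF).
rewrite -mul_mpolyC rmorphM mulrA [RHS]mulrA; congr (_ * _).
(* Viewing the embedding of constants as one ring morphism lets the division by 2 be cleared inside
   [K]. *)
pose iota : {rmorphism K -> {fraction {mpoly K[n]}}} := mfrac \o @mpolyC n K.
have -> : 2%:R * mfrac (beta * r%:R / 2%:R * 'C(n, r)%:R * (n%:R - 1))%:MP_[n] =
          mfrac beta%:MP_[n] * (r%:R * 'C(n, r)%:R * (n%:R - 1)).
  have iotaE c : mfrac c%:MP = iota c by [].
  rewrite !iotaE -(rmorph_nat iota 2) -[LHS]rmorphM.
  rewrite (_ : 2%:R * _ = beta * (r%:R * 'C(n, r)%:R * (n%:R - 1))); last by field.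
  by rewrite !(rmorphM iota) (rmorphB iota) (rmorph1 iota) !(rmorph_nat iota).
rewrite mulrDr [2%:R * (_ * W)]mulrCA [2%:R * W]mulr_natl W2.
(* The integer division is exact because r(r-1) is even. *)
have tri : 2%:R * ((r * r.-1) %/ 2)%:R = (r * r.-1)%:R :> {fraction {mpoly K[n]}}.
  by rewrite -natrM mulnC divnK // dvdn2 oddM; case: (r) r_ge1 => //= k _; case: odd.
rewrite -mulrnA -[_ *+ (_ * _)]mulr_natr [(_ * 'C(n, r))%:R]natrM.
rewrite mulrCA [2%:R * (_ * _)]mulrA tri -mulrDr; congr (_ * _).
have -> : r.-1 = (r - 1)%N by rewrite subn1.
(* The bounds 1 <= r <= n turn truncated subtractions into genuine ones; what remains is r(r-1) +
   r(n-r) = r(n-1), times the binomial. *)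
rewrite !natrM !natrB //; ring.
Qed.
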